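(* Let $a\in\mathbb{N}$ and $\omega,\Omega,r\in\mathbb{Q}$ with $a>\Omega\geq\omega\geq 1$ and $r\geq 1$, and put $$\chi=\exp\Bigl(\frac{\omega\log 2+3\omega^2+\omega^2\log(a+1)+\frac12\Omega^2\log r}{a-\omega}\Bigr).$$ Then there is a sequence $(\varepsilon_n)$ of real numbers tending to $0$ as $n\to\infty$ (depending only on $a,\omega,\Omega,r$) such that for every integer $n\geq 0$ with $rn,\omega n,\Omega n\in\mathbb{N}$ there exist integers $c_{i,j}$ ($1\leq i\leq a$, $0\leq j\leq n$), not all zero, such that, with $F_n(X)=\sum_{i=1}^a\sum_{j=0}^n \frac{c_{i,j}}{(X+j)^i}$ and $F_n(t)=\sum_{d\geq1}\mathfrak{A}_d t^{-d}$ its expansion at infinity: (i) $F_n(t)=O(t^{-\omega n})$ as $|t|\to\infty$; (ii) $|c_{i,j}|\leq \chi^{n(1+\varepsilon_n)}$ for all $i,j$; (iii) for every integer $1\leq d<\Omega n$, $|\mathfrak{A}_d|\leq r^{d-\Omega n}\,n^d\,d^a\,\chi^{n(1+\varepsilon_n)}$.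
   Context: The expansion $F_n(t)=\sum_{d\geq 1}\mathfrak{A}_d t^{-d}$ is the Laurent expansion of the rational function $F_n$ at $t=\infty$ (valid for $|t|>n$). *)

(* Defs.v *)
From HB Require Import structures.
From mathcomp Require Import all_boot all_order all_algebra.
From mathcomp Require Import all_classical all_reals all_analysis.
From mathcomp Require Import complex.
Set Implicit Arguments.
Unset Strict Implicit.
Unset Printing Implicit Defensive.
Import Order.TTheory GRing.Theory Num.Theory.
Import numFieldNormedType.Exports.
Local Open Scope classical_set_scope.
Local Open Scope ring_scope.
Local Open Scope complex_scope.

(* Complex variables live in R[i]^o, the regular algebra of R[i], because this
   is the type that carries the normed-module structure. *)

Definition complex_infty {R : realType} : set_system R[i]^o :=
  [set P | exists M : R, forall t : R[i]^o, M%:C < `|t| -> P t].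

Global Instance complex_infty_filter (R : realType) :
  Filter (@complex_infty R).
Proof.
split.
- by exists 0.
- move=> P Q [M HM] [N HN]; exists (Num.max M N) => t Ht.
  by split; [apply: HM | apply: HN]; apply: le_lt_trans Ht;
    rewrite lecR le_max lexx ?orbT.
- by move=> P Q PQ [M HM]; exists M => t /HM /PQ.
Qed.

Canonical complex_infty_filter_on (R : realType) :=
  FilterType (@complex_infty R) (complex_infty_filter R).

(* [t |-> F t] equals the sum over d >= 1 of [A d * t ^ (-d)] whenever
   [rho < |t|]; the value [A 0] is irrelevant. By uniqueness of Laurent
   expansions this determines [A d] for all d >= 1. *)
Definition expansion_at_infty (R : realType) (F : R[i]^o -> R[i]^o)
    (A : nat -> R[i]^o) (rho : R) : Prop :=
  forall t : R[i]^o, rho%:C < `|t| ->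
    series (fun d : nat => A d.+1 * t ^- d.+1) @ \oo --> F t.

(* Rows are shifted by one: [c i j] is the coefficient of 1 / (X + j) ^ (i+1).
   The junk values of the inverse at the poles -n, ..., 0 are never used. *)
Definition partial_fraction (R : realType) (a n : nat)
    (c : 'M[int]_(a, n.+1)) (t : R[i]^o) : R[i]^o :=
  \sum_(i < a) \sum_(j < n.+1) (c i j)%:~R / (t + j%:R) ^+ i.+1.

Arguments partial_fraction R {a n} c t.

Definition chi (R : realType) (a : nat) (omega Omega r : rat) : R :=
  expR ((ratr omega * ln 2 + 3 * ratr omega ^+ 2
         + ratr omega ^+ 2 * ln (a%:R + 1)
         + 2^-1 * ratr Omega ^+ 2 * ln (ratr r))
        / (a%:R - ratr omega)).

(* Main.v *)
Require Import Defs.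
From HB Require Import structures.
From mathcomp Require Import all_boot all_order all_algebra.
From mathcomp Require Import all_classical all_reals all_analysis.
From mathcomp Require Import complex.
From mathcomp Require Import zify ring lra.
Set Implicit Arguments.
Unset Strict Implicit.
Unset Printing Implicit Defensive.
Import Order.TTheory GRing.Theory Num.Theory.
Import numFieldNormedType.Exports.
Local Open Scope classical_set_scope.
Local Open Scope ring_scope.
Local Open Scope complex_scope.

(** Expanding at infinity, [A_d] is the sum over i, j of [c_ij] times the
    coefficient of order i - 1 of [X ^ (d - 1)] in its Taylor expansion at -j.
    The equations [A_d = 0] for [d < omega n] are therefore equivalent to those
    obtained when the powers [X ^ k] are replaced by the binomial polynomials
    [binom(X, k)], whose Taylor coefficients of order below a at the points -j
    are at most [2 ^ (j + k)] and have a common denominator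
    [a! * prod_(1 <= m <= a) lcm(1, ..., k / m)], of size
    [exp(O(k (1 + log a)))] since [lcm(1, ..., x) <= 4 ^ x].  The box principle
    applied to these equations, and to the inequalities bounding [A_d] for
    [omega n <= d < Omega n], yields the [c_ij].  The equations cost
    [omega log 2 + 3 omega^2 + omega^2 log(a + 1)] and the inequalities
    [Omega^2 (log r) / 2], both in the scale [n ^ 2], while
    [a (n + 1) - omega n] free unknowns remain to pay for them. *)

(** * Least common multiples of initial segments *)

Definition lcm_upto (k : nat) : nat := \big[lcmn/1%N]_(i < k) i.+1.

Lemma dvdn_lcm_upto (k l : nat) : (0 < l <= k)%N -> (l %| lcm_upto k)%N.
Proof.
case: l => // l /andP[_ lk]; exact: (@biglcmn_sup _ (Ordinal lk)).
Qed.

Lemma lcm_upto_gt0 (k : nat) : (0 < lcm_upto k)%N.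
Proof.
rewrite /lcm_upto; elim/big_ind: _ => // x y x0 y0.
by rewrite lcmn_gt0 x0 y0.
Qed.

(** Terms with [p ^ k > n] vanish in Legendre's formula; a common upper limit lets several
    factorials be compared term by term. *)
Lemma logn_fact_widen (p n N : nat) : prime p -> (n <= N)%N ->
  logn p n`! = (\sum_(1 <= k < N.+1) n %/ p ^ k)%N.
Proof.
move=> pp nN; rewrite logn_fact // [RHS](@big_cat_nat _ _ _ n.+1) //=.
rewrite [X in (_ + X)%N]big_nat_cond [X in (_ + X)%N]big1 ?addn0 // => k.
rewrite andbT => /andP[nk _]; rewrite divn_small //.
by apply: leq_trans nk _; apply: ltnW; apply: ltn_expl; apply: prime_gt1.
Qed.

Lemma leq_add_div (d m n : nat) : (0 < d)%N -> (m %/ d + n %/ d <= (m + n) %/ d)%N.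
Proof. by move=> d0; rewrite leq_divRL // mulnDl leq_add // leq_trunc_div. Qed.

(* Kummer: a carry at [p ^ e] occurs when adding [m] and [m'] in base [p]. *)
Lemma prime_dvd_bin (p e m m' : nat) : prime p -> (0 < e)%N ->
  (m < p ^ e)%N -> (m' < p ^ e)%N -> (p ^ e <= m + m')%N ->
  (p %| 'C(m + m', m))%N.
Proof.
move=> pp e0 mq m'q qN.
have C0 : (0 < 'C(m + m', m))%N by rewrite bin_gt0 leq_addr.
have eN : (e < (m + m').+1)%N.
  by rewrite ltnS; apply: leq_trans qN; apply: ltnW; apply: ltn_expl; apply: prime_gt1.
have := bin_fact (leq_addr m' m); rewrite addKn => /(congr1 (logn p)).
rewrite lognM ?muln_gt0 ?fact_gt0 // lognM ?fact_gt0 //.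
rewrite (@logn_fact_widen p m (m + m')) ?leq_addr //.
rewrite (@logn_fact_widen p m' (m + m')) ?leq_addl //.
rewrite (@logn_fact_widen p (m + m') (m + m')) // -big_split /= => Hl.
have : (0 < logn p 'C(m + m', m))%N.
  have div_le k : (m %/ p ^ k + m' %/ p ^ k <= (m + m') %/ p ^ k)%N.
    by apply: leq_add_div; rewrite expn_gt0 prime_gt0.
  rewrite -(ltn_add2r (\sum_(1 <= k < (m + m').+1) (m %/ p ^ k + m' %/ p ^ k))).
  rewrite Hl add0n.
  rewrite (@big_cat_nat _ _ _ e) //=; last exact: ltnW.
  rewrite [ltnRHS](@big_cat_nat _ _ _ e) //=; last exact: ltnW.
  rewrite -addnS leq_add //; first by apply: leq_sum => k _.
  rewrite big_ltn // [ltnRHS]big_ltn // -addSn leq_add //.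
    by rewrite (divn_small mq) (divn_small m'q) divn_gt0 // expn_gt0 prime_gt0.
  by apply: leq_sum => k _.
by rewrite logn_gt0 mem_primes => /and3P[].
Qed.

(** A prime power [p ^ e <= m + m'] is either at most [m'], or adding [m] and [m'] carries at
    [p ^ e]; then [p] divides the binomial coefficient, while [p ^ (e - 1) <= m']. *)
Lemma lcm_upto_halve (m m' : nat) : (m <= m')%N ->
  (lcm_upto (m + m') %| lcm_upto m' * 'C(m + m', m))%N.
Proof.
move=> mm'; apply/dvdn_biglcmP => -[l lN] _ /=.
apply/dvdn_partP => // p; rewrite mem_primes => /and3P[pp _ pl].
rewrite p_part; set e := logn p l.+1.
have e0 : (0 < e)%N by rewrite logn_gt0 mem_primes pp pl.
have qN : (p ^ e <= m + m')%N.
  by apply: leq_trans lN; apply: dvdn_leq => //; exact: pfactor_dvdnn.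
have q0 : (0 < p ^ e)%N by rewrite expn_gt0 prime_gt0.
have [qm|mq] := leqP (p ^ e) m'.
  by apply/dvdn_mulr/dvdn_lcm_upto; rewrite q0.
rewrite -(prednK e0) expnSr dvdn_mul //.
  apply: dvdn_lcm_upto; rewrite expn_gt0 prime_gt0 //=.
  have := prime_gt1 pp; move: qN; rewrite -{1}(prednK e0) expnS.
  nia.
by apply: (@prime_dvd_bin p e) => //; apply: leq_ltn_trans mq.
Qed.

Lemma leq_bin_exp2 (n m : nat) : ('C(n.+1, m) <= 2 ^ n)%N.
Proof.
elim: n m => [|n IHn] [|m]; rewrite ?bin0 ?expn_gt0 //; first by case: m.
by rewrite binS expnS mul2n -addnn leq_add.
Qed.

(** Halving [n] costs a factor ['C(n, m)] with [m] the floor of [n / 2], and this is at most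
    [4 ^ m]. For odd [n] it is half of the next central binomial coefficient. *)
Lemma lcm_upto_le (n : nat) : (lcm_upto n <= 4 ^ n)%N.
Proof.
elim/ltn_ind: n => n IHn.
have [n1|n1] := leqP n 1.
  by case: n n1 {IHn} => [|[|//]] _; rewrite /lcm_upto ?big_ord0 ?big_ord1.
set m := n./2; set m' := (n - m)%N.
have [mm' mn m'n] : [/\ m <= m', n = m + m' & m' < n]%N.
  by rewrite /m' /m; split; lia.
have Cb : ('C(n, m) <= 4 ^ m)%N.
  have [oddn|evenn] := boolP (odd n).
    have -> : n = m.*2.+1 by rewrite /m; lia.
    suff : (2 * 'C(m.*2.+1, m) <= 2 ^ m.*2.+1)%N.
      by rewrite expnS leq_pmul2l // -mul2n expnM.
    have e : 'C(m.*2.+1, m) = 'C(m.*2.+1, m.+1).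
      rewrite -bin_sub; last lia.
      by congr ('C(_, _)); lia.
    have -> : (2 * 'C(m.*2.+1, m) = 'C(m.*2.+2, m.+1))%N.
      by rewrite binS -e mul2n addnn.
    exact: leq_bin_exp2.
  have -> : n = m.*2 by rewrite /m; lia.
  rewrite (_ : 4 = 2 ^ 2)%N // -expnM mul2n.
  rewrite -[in X in 'C(X, _)](@prednK m.*2); last by lia.
  by apply: leq_trans (leq_bin_exp2 _ _) _; rewrite leq_exp2l // leq_pred.
have n4 : (4 ^ n = 4 ^ m' * 4 ^ m)%N by rewrite -expnD addnC -mn.
rewrite n4; apply: leq_trans (leq_mul (IHn _ m'n) Cb).
rewrite dvdn_leq ?muln_gt0 ?lcm_upto_gt0 ?bin_gt0 //; first by rewrite mn leq_addr.
by have := lcm_upto_halve mm'; rewrite -mn.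
Qed.

(* The least entry of a list of [h.+1] positive integers with sum at most [k]
   is at most [k %/ h.+1]. *)
Lemma prod_dvd_lcm_upto (s : seq nat) (h k : nat) :
  all (leq 1) s -> (size s <= h)%N -> (sumn s <= k)%N ->
  (\prod_(x <- s) x %| \prod_(m < h) lcm_upto (k %/ m.+1))%N.
Proof.
elim: h s => [|h IHh] s s0 sh sk.
  by move: sh; rewrite leqn0 => /nilP ->; rewrite big_nil dvd1n.
rewrite big_ord_recr /=.
have [sh'|hs] := leqP (size s) h; first by apply/dvdn_mulr/IHh.
have {hs} sE : size s = h.+1 by apply/eqP; rewrite eqn_leq sh.
(* A smallest entry is matched with the last factor; the other entries fall to the induction
   hypothesis. *)
have [x xs xmin] : exists2 x, x \in s & all (leq x) s.
  case: s sE {s0 sh sk} => // y s _.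
  elim: s y => [|z s IHs] y; first by exists y; rewrite ?mem_head //= leqnn.
  have [x xs xmin] := IHs z.
  have [yx|xy] := leqP y x.
    exists y; rewrite ?mem_head //= leqnn /=.
    by apply: sub_all xmin => u; apply: leq_trans.
  by exists x; rewrite 1?in_cons ?xs ?orbT //=; rewrite ltnW.
have sr := perm_to_rem xs.
have sumr : (sumn s = x + sumn (rem x s))%N by rewrite (perm_sumn sr).
rewrite (perm_big _ sr) big_cons [X in (_ %| X)%N]mulnC dvdn_mul //; last first.
  apply: IHh.
  - by move: s0; rewrite (perm_all _ sr) => /andP[].
  - by rewrite size_rem // sE.
  - by apply: leq_trans sk; rewrite sumr leq_addl.
apply: dvdn_lcm_upto; rewrite (allP s0 _ xs) leq_divRL //= (leq_trans _ sk) //.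
rewrite mulnC -sE; elim: s xmin {s0 sh sk sE xs sr sumr} => //= y s IHs /andP[xy xs].
by rewrite mulSn leq_add // IHs.
Qed.

(** * Binomial polynomials and their Taylor coefficients *)

Definition binomp (K : fieldType) (k : nat) : {poly K} :=
  \prod_(i < k) (i.+1%:R^-1 *: ('X - i%:R%:P)).

Section BinomialPolynomials.
Variable K : numFieldType.
Implicit Types (k l m h j : nat) (c : K).

Lemma binomp0 : binomp K 0 = 1.
Proof. by rewrite /binomp big_ord0. Qed.

Lemma binompS k : k.+1%:R *: binomp K k.+1 = ('X - k%:R%:P) * binomp K k.
Proof.
rewrite /binomp big_ord_recr /= scalerAr scalerA divff ?pnatr_eq0 //.
by rewrite scale1r mulrC.
Qed.

Lemma scaler_natI k (p q : {poly K}) : k.+1%:R *: p = k.+1%:R *: q -> p = q.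
Proof. by apply: scalerI; rewrite pnatr_eq0. Qed.

Lemma mulX_binomp k :
  'X * binomp K k = k.+1%:R *: binomp K k.+1 + k%:R *: binomp K k.
Proof. by rewrite binompS mulrBl -mul_polyC subrK. Qed.

Lemma mulX_binomp_shift k :
  'X * (binomp K k \Po ('X - 1%:P)) = k.+1%:R *: binomp K k.+1.
Proof.
elim: k => [|k IHk].
  by rewrite binompS binomp0 comp_polyC subr0.
rewrite binompS; apply: (@scaler_natI k).
rewrite !scalerAr -comp_polyZ {1}binompS comp_polyM mulrCA IHk.
congr (_ * _).
by rewrite comp_polyB comp_polyX comp_polyC -addrA -opprD -polyCD nat1r.
Qed.

(** Pascal's rule, obtained from the absorption identity [mulX_binomp_shift]. *)
Lemma binomp_shift k : binomp K k.+1 \Po ('X - 1%:P) =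
  binomp K k.+1 - (binomp K k \Po ('X - 1%:P)).
Proof.
apply: (@scaler_natI k); rewrite -comp_polyZ binompS comp_polyM scalerBr.
rewrite -mulX_binomp_shift comp_polyB comp_polyX comp_polyC -mul_polyC -mulrBl.
by rewrite -[_ - 1%:P - _]addrA -opprD -polyCD nat1r.
Qed.

Lemma binomp_shiftS j k : binomp K k.+1 \Po ('X - j.+1%:R%:P) =
  (binomp K k.+1 \Po ('X - j%:R%:P)) - (binomp K k \Po ('X - j.+1%:R%:P)).
Proof.
have e : 'X - j.+1%:R%:P = ('X - 1%:P) \Po ('X - j%:R%:P) :> {poly K}.
  by rewrite comp_polyB comp_polyX comp_polyC -natr1 polyCD -addrA -opprD.
by rewrite e !comp_polyA binomp_shift comp_polyB.
Qed.

(** Multiplying by [X - k] increases the coefficient bound at most by the factor [k + 1], which the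
    normalisation divides out. *)
Lemma coef_binomp_le1 k h : `|(binomp K k)`_h| <= 1.
Proof.
elim: k h => [|k IHk] h.
  by rewrite binomp0 coef1; case: (h == 0); rewrite ?normr1 ?normr0.
have k0 : 0 < k.+1%:R :> K by rewrite ltr0n.
rewrite -(ler_pM2l k0) -{1}(gtr0_norm k0) -normrM -coefZ binompS mulr1.
rewrite mulrBl coefB coefXM coefCM.
apply: le_trans (ler_normB _ _) _; rewrite normrM normr_nat -natr1 addrC.
rewrite lerD //; first by rewrite -[leRHS]mulr1 ler_wpM2l.
by case: eqP => // _; rewrite normr0.
Qed.

(** By Pascal's rule a double induction applies, and [2 ^ (j + k)] satisfies the same recurrence
    with all signs positive. *)
Lemma coef_binomp_shift_le k j h :
  `|(binomp K k \Po ('X - j%:R%:P))`_h| <= 2 ^+ (j + k).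
Proof.
elim: j k => [|j IHj] k.
  rewrite subr0 comp_polyXr (le_trans (coef_binomp_le1 _ _)) //.
  by rewrite exprn_ege1 // ler1n.
elim: k => [|k IHk].
  rewrite binomp0 comp_polyC coefC; case: eqP => _; rewrite ?normr0 ?normr1 ?exprn_ge0 //.
  by rewrite exprn_ege1 // ler1n.
rewrite binomp_shiftS coefB (le_trans (ler_normB _ _)) //.
have -> : 2 ^+ (j.+1 + k.+1) = 2 ^+ (j + k.+1) + 2 ^+ (j.+1 + k) :> K.
  by rewrite !addSn !addnS exprS mulr_natl mulr2n.
by rewrite lerD.
Qed.

(* Coefficientwise, [d/dx (1+z)^x = log(1+z) (1+z)^x]. *)
Lemma deriv_binomp l : (binomp K l)^`() =
  \sum_(m < l) ((-1) ^+ m / m.+1%:R) *: binomp K (l - m.+1).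
Proof.
elim: l => [|l IHl].
  by rewrite binomp0 big_ord0 derivC.
apply: (@scaler_natI l); rewrite -derivZ binompS derivM derivB derivX derivC.
rewrite subr0 mul1r IHl mulr_sumr scaler_sumr.
(* Each term splits in two. After a shift of index, the second halves together with [binom(X, l)]
   make up the gap between the factors [l - m] and [l + 1]. *)
have term (m : 'I_l) : ('X - l%:R%:P) *
    (((-1) ^+ m / m.+1%:R) *: binomp K (l - m.+1)) =
  ((-1) ^+ m * (l - m)%:R / m.+1%:R) *: binomp K (l - m)
    - (-1) ^+ m *: binomp K (l - m.+1).
  rewrite -scalerAr mulrBl mul_polyC mulX_binomp.
  have -> : (l - m.+1).+1 = (l - m)%N by have := ltn_ord m; lia.
  rewrite -addrA -scalerBl scalerDr !scalerA mulrAC; congr (_ + _).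
  rewrite -scaleNr; congr (_ *: _).
  have -> : l%:R = (l - m.+1)%:R + m.+1%:R :> K.
    by rewrite -natrD; congr _%:R; have := ltn_ord m; lia.
  by field; rewrite nat1r pnatr_eq0.
under eq_bigr => m _ do rewrite term.
rewrite sumrB big_ord_recr /= subnn scalerA.
under [in RHS]eq_bigr => m _.
  rewrite scalerA subSS (_ : l.+1%:R * _ =
    (-1) ^+ m * (l - m)%:R / m.+1%:R + (-1) ^+ m); last first.
    have -> : l.+1%:R = (l - m)%:R + m.+1%:R :> K.
      by rewrite -natrD; congr _%:R; have := ltn_ord m; lia.
    by field; rewrite nat1r pnatr_eq0.
  rewrite scalerDl; over.
rewrite big_split /= addrCA -[RHS]addrA; congr (_ + _).
have -> : l.+1%:R * ((-1) ^+ l / l.+1%:R) = (-1) ^+ l :> K.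
  by field; rewrite nat1r pnatr_eq0.
have -> : \sum_(m < l) (-1) ^+ m *: binomp K (l - m) + (-1) ^+ l *: binomp K 0
   = \sum_(m < l.+1) (-1) ^+ m *: binomp K (l - m).
  by rewrite big_ord_recr /= subnn.
rewrite big_ord_recl /= expr0 scale1r subn0; congr (_ + _).
by rewrite -sumrN; apply: eq_bigr => m _; rewrite /bump /= add1n exprS mulN1r scaleNr.
Qed.

Lemma binomp_span (L : {poly K} -> K) (p : nat) : linear L ->
  (forall k, (k < p)%N -> L (binomp K k) = 0) ->
  forall m, (m < p)%N -> L 'X^m = 0.
Proof.
move=> Llin L0 m mp.
(* The mixed products allow induction on [m]: multiplying [binom(X, k)] by [X] raises [k] by at most
   one. *)
suff H k : (m + k < p)%N -> L ('X^m * binomp K k) = 0.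
  by have := H 0; rewrite addn0 binomp0 mulr1 => ->.
elim: m k {mp} => [|m IHm] k mkp; first by rewrite mul1r L0.
rewrite exprSr -mulrA mulX_binomp mulrDr -!scalerAr Llin.
rewrite IHm; last by rewrite addnS -addSn.
rewrite -[X in L X]addr0 Llin IHm; last by apply: ltn_trans mkp.
suff -> : L 0 = 0 by rewrite /GRing.scale /= !mulr0 !addr0.
by have := Llin (-1) 0 0; rewrite scaler0 addr0 scaleN1r addNr.
Qed.

End BinomialPolynomials.

(** Each derivative brings a denominator [m] and lowers the index by [m], so [h] derivatives bring
    products of at most [h] positive integers of sum at most [k]. Dividing [M] by [m] preserves the
    hypothesis for [h - 1] and [k - m]. *)
Lemma binomp_coef_int (R : archiRealFieldType) (M h k : nat) :
  (forall s, all (leq 1) s -> (size s <= h)%N -> (sumn s <= k)%N ->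
    (\prod_(x <- s) x %| M)%N) ->
  forall l, (l <= k)%N -> (M * h`!)%:R * (binomp R l)`_h \is a Num.int.
Proof.
elim: h M k => [|h IHh] M k MP l lk.
  apply: rpredM; first exact: natr_int.
  case: l lk => [|l] lk; first by rewrite binomp0 coef1 natr_int.
  rewrite -horner_coef0 /binomp big_ord_recl /= subr0 invr1 scale1r.
  by rewrite hornerM hornerX mul0r rpred0.
rewrite factS mulnA [(M * _)%N]mulnC -mulnA mulnC natrM -mulrA.
rewrite [h.+1%:R * _]mulr_natl -coef_deriv deriv_binomp coef_sum mulr_sumr.
apply: rpred_sum => m _; rewrite coefZ.
have m1l : (m.+1 <= l)%N by [].
have m1k := leq_trans m1l lk.
have /dvdnP[M' ME] : (m.+1 %| M)%N.
  by have := MP [:: m.+1]; rewrite big_seq1; apply => //=; rewrite addn0.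
have -> : (M * h`!)%:R * ((-1) ^+ m / m.+1%:R * (binomp R (l - m.+1))`_h) =
   (-1) ^+ m * ((M' * h`!)%:R * (binomp R (l - m.+1))`_h).
  by rewrite ME !natrM; field; rewrite nat1r pnatr_eq0.
apply: rpredM; first by apply/rpredX/rpredN1.
apply: (IHh M' (k - m.+1)%N); last exact: leq_sub2r.
move=> s s1 sh sk; rewrite -(@dvdn_pmul2r m.+1) // -ME.
have := MP (m.+1 :: s); rewrite big_cons mulnC; apply => //=.
by rewrite -(subnKC m1k) leq_add2l.
Qed.

(** The product clears the denominators of iterated derivatives; the factorial turns derivatives
    into Taylor coefficients. *)
Definition binomp_den (a k : nat) : nat :=
  (\prod_(m < a) lcm_upto (k %/ m.+1) * a`!)%N.

Lemma binomp_shift_coef_int (R : archiRealFieldType) (a k h j : nat) :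
  (h <= a)%N -> (binomp_den a k)%:R *
    (binomp R k \Po ('X - j%:R%:P))`_h \is a Num.int.
Proof.
(* Pascal's rule involves lower indices, so one denominator must serve all [l <= k]. *)
move=> ha; suff H l : (l <= k)%N ->
    (binomp_den a k)%:R * (binomp R l \Po ('X - j%:R%:P))`_h \is a Num.int.
  exact: H.
elim: j l => [|j IHj] l lk.
  rewrite subr0 comp_polyXr /binomp_den.
  have /dvdnP[q ->] : (h`! %| a`!)%N by rewrite -(bin_fact ha) dvdn_mull ?dvdn_mulr.
  rewrite mulnCA natrM -mulrA; apply: rpredM; first exact: natr_int.
  apply: binomp_coef_int lk => s s1 sh sk.
  by apply: prod_dvd_lcm_upto => //; apply: leq_trans ha.
elim: l lk => [|l IHl] lk.
  rewrite binomp0 comp_polyC coefC; apply: rpredM; first exact: natr_int.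
  by case: eqP => _; rewrite ?rpred1 ?rpred0.
by rewrite binomp_shiftS coefB mulrBr; apply: rpredB; [exact: IHj|apply/IHl/ltnW].
Qed.

(** * Siegel's lemma *)

(* Siegel's lemma by the box principle, for real forms: the value of the [v]-th
   form on [0, H]^U lies in an interval covered by [B v] boxes of width [G v],
   and a width-one box turns the bound into an equation for integral forms. *)
Lemma siegel_pigeonhole (R : archiRealFieldType) (U V : finType) (H : nat)
    (f : V -> U -> R) (G : V -> R) (B : V -> nat) :
  (forall v, 0 < G v) ->
  (forall v, H%:R * \sum_u `|f v u| < G v * (B v)%:R) ->
  (\prod_v B v < H.+1 ^ #|U|)%N ->
  exists2 x : U -> int, exists u, x u != 0 &
    (forall u, `|x u| <= H%:Z) /\
    (forall v, `|\sum_u (x u)%:~R * f v u| < G v).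
Proof.
move=> G0 HB cardB.
pose F (x : {ffun U -> 'I_H.+1}) v : R := \sum_u (x u)%:R * f v u.
(* The least value of the form on the cube, reached by taking [H] exactly where the coefficient is
   negative. *)
pose lo v : R := H%:R * \sum_u Num.min 0 (f v u).
have Flo x v : 0 <= F x v - lo v.
  rewrite /F /lo mulr_sumr -sumrB sumr_ge0 // => u _; rewrite subr_ge0.
  have xH : (x u)%:R <= H%:R :> R by rewrite ler_nat -ltnS.
  have [f0|f0] := leP 0 (f v u); first by rewrite mulr0 mulr_ge0.
  by rewrite ler_wnM2r // ltW.
have Fhi x v : F x v - lo v <= H%:R * \sum_u `|f v u|.
  rewrite /F /lo !mulr_sumr -sumrB ler_sum // => u _.
  have xH : (x u)%:R <= H%:R :> R by rewrite ler_nat -ltnS.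
  have [f0|f0] := leP 0 (f v u).
    by rewrite mulr0 subr0 ger0_norm // ler_wpM2r.
  rewrite ltr0_norm // -mulrBl mulrN -mulNr ler_wnM2r //; first exact: ltW.
  by rewrite lerBrDr addNr.
have boxP x v : (Num.trunc ((F x v - lo v) / G v) < B v)%N.
  rewrite -(ltr_nat R); apply: le_lt_trans (_ : (F x v - lo v) / G v < _).
    by have /andP[] := truncn_itv (divr_ge0 (Flo x v) (ltW (G0 v))).
  by rewrite ltr_pdivrMr // mulrC; apply: le_lt_trans (HB v).
pose box (x : {ffun U -> 'I_H.+1}) : {dffun forall v, 'I_(B v)} :=
  [ffun v => Ordinal (boxP x v)].
have /injectivePn[x [y xy boxxy]] : ~~ injectiveb box.
  apply/injectiveP => /leq_card; apply/negP; rewrite -ltnNge.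
  rewrite card_ffun card_ord card_dep_ffun foldrE big_map big_enum /=.
  by under eq_bigr => v _ do rewrite card_ord.
(* Two points in one box differ by a vector with entries at most [H], at which every form is smaller
   than its box width. *)
exists (fun u => (x u)%:Z - (y u)%:Z).
  have : ~~ [forall u, x u == y u].
    by apply: contraNN xy => /forallP xy; apply/eqP/ffunP => u; apply/eqP.
  rewrite negb_forall => /existsP[u xyu]; exists u.
  by rewrite subr_eq0 eqz_nat.
split=> [u|v].
  by have := ltn_ord (x u); have := ltn_ord (y u); lia.
have -> : \sum_u ((x u)%:Z - (y u)%:Z)%:~R * f v u
          = (F x v - lo v) - (F y v - lo v).
  rewrite /F opprB addrA subrK -sumrB; apply: eq_bigr => u _.
  by rewrite rmorphB /= mulrBl.
have := congr1 (fun g : {dffun forall v, 'I_(B v)} => val (g v)) boxxy.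
rewrite /= !ffunE /=.
set p := F x v - lo v; set q := F y v - lo v => pq.
have /andP[p1 p2] := truncn_itv (divr_ge0 (Flo x v) (ltW (G0 v))).
have /andP[] := truncn_itv (divr_ge0 (Flo y v) (ltW (G0 v))).
rewrite -/p -/q in p1 p2 *; rewrite -pq => q1 q2.
have -> : p - q = (p / G v - q / G v) * G v.
  by rewrite mulrBl !divfK // gt_eqF.
rewrite normrM (gtr0_norm (G0 v)) gtr_pMl // ltr_norml.
rewrite -natr1 in p2 q2.
by apply/andP; split; lra.
Qed.

(** * Expansion at infinity of powers of simple fractions *)

(** This is [binom(m, i) * w ^ (m - i)], also the coefficient of [t ^ -(m + 1)] in
    [(t - w) ^ -(i + 1)]. As a polynomial coefficient it vanishes by itself for [i > m]. *)
Definition powcoef (K : nzRingType) (m i : nat) (w : K) : K :=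
  (('X + w%:P) ^+ m)`_i.

Section PowerCoefficients.
Variable K : comNzRingType.
Implicit Types (m i : nat) (w : K).

Lemma powcoef0 i w : powcoef 0 i w = (i == 0)%:R.
Proof. by rewrite /powcoef expr0 coef1. Qed.

Lemma powcoefS m i w :
  powcoef m.+1 i.+1 w = powcoef m i w + w * powcoef m i.+1 w.
Proof. by rewrite /powcoef exprS mulrDl coefD coefXM coefCM. Qed.

Lemma powcoefS0 m w : powcoef m.+1 0 w = w * powcoef m 0 w.
Proof. by rewrite /powcoef exprS mulrDl coefD coefXM coefCM add0r. Qed.

End PowerCoefficients.

Lemma map_powcoef (K L : comNzRingType) (f : {rmorphism K -> L}) m i (w : K) :
  f (powcoef m i w) = powcoef m i (f w).
Proof.
by rewrite /powcoef -coef_map rmorphXn rmorphD /= map_polyX map_polyC.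
Qed.

(** An exact remainder after [m] terms: writing [t = (t - w) + w] and applying the recurrence of
    [powcoef] passes from [m] to [m + 1]. *)
Lemma inv_pow_expansion (K : fieldType) (t w : K) (i m : nat) :
  t != 0 -> t - w != 0 ->
  ((t - w) ^+ i.+1)^-1 - \sum_(d < m) powcoef d i w / t ^+ d.+1 =
  (t ^+ m)^-1 * \sum_(l < i.+1) powcoef m l w / (t - w) ^+ (i.+1 - l).
Proof.
move=> t0 v0; set v := t - w in v0 *.
elim: m => [|m IHm].
  rewrite big_ord0 subr0 expr0 invr1 mul1r big_ord_recl /= powcoef0 mul1r subn0.
  by rewrite big1 ?addr0 // => l _; rewrite powcoef0 mul0r.
rewrite big_ord_recr /= opprD addrA IHm.
set S := \sum_(l < i.+1) powcoef m l w / _.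
suff e : t * S = powcoef m i w + \sum_(l < i.+1) powcoef m.+1 l w / v ^+ (i.+1 - l).
  have T0 := expf_neq0 m t0; move: e.
  set S' := \sum_(l < i.+1) powcoef m.+1 l w / v ^+ (i.+1 - l) => e.
  rewrite (_ : S = (powcoef m i w + S') / t); last by rewrite -e mulrC mulKf.
  by rewrite exprS; field; rewrite t0 T0.
have -> : t = v + w by rewrite /v subrK.
have vS : v * S = \sum_(l < i) powcoef m l w / v ^+ (i - l) + powcoef m i w.
  rewrite /S mulr_sumr big_ord_recr /= subSnn expr1; congr (_ + _).
    by apply: eq_bigr => l _; rewrite subSn ?(ltnW (ltn_ord l)) // exprS; field;
      rewrite expf_neq0.
  by rewrite mulrC divfK.
rewrite mulrDl vS addrAC addrC; congr (_ + _).
rewrite /S mulr_sumr !big_ord_recl /= powcoefS0 mulrA addrCA; congr (_ + _).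
rewrite -big_split /=; apply: eq_bigr => l _.
by rewrite /bump /= add1n subSS powcoefS mulrA -mulrDl.
Qed.

Section PowerCoefficientBounds.
Variable K : numFieldType.
Implicit Types (m i n : nat) (w y : K).

(** The left side is one term of the binomial expansion of the right side. A small [y] gives
    convergence for all [|t| > n]. *)
Lemma powcoef_geometric m i w y : 0 <= y ->
  `|powcoef m i w| * y ^+ i <= (`|w| + y) ^+ m.
Proof.
move=> y0; elim: m i => [|m IHm] i.
  rewrite powcoef0 expr0; case: i => [|i]; first by rewrite normr1 mulr1.
  by rewrite normr0 mul0r ler01.
case: i => [|i].
  rewrite powcoefS0 normrM exprS mulr1.
  have := IHm 0; rewrite mulr1 => H.
  by apply: ler_pM => //; rewrite lerDl.
rewrite powcoefS [leRHS]exprS mulrDl.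
apply: le_trans (_ : (`|powcoef m i w| + `|w| * `|powcoef m i.+1 w|) * y ^+ i.+1 <= _).
  by rewrite ler_wpM2r ?exprn_ge0 // -normrM ler_normD.
rewrite mulrDl -mulrA addrC lerD ?ler_wpM2l //.
by rewrite exprS mulrCA ler_wpM2l.
Qed.

Lemma powcoef_le m i n w : (0 < n)%N -> `|w| <= n%:R ->
  `|powcoef m i w| <= (m.+1 ^ i * n ^ m)%:R.
Proof.
move=> n0 wn; elim: m i => [|m IHm] i.
  by rewrite powcoef0 exp1n; case: (i == 0)%N; rewrite ?normr1 ?normr0.
case: i => [|i].
  rewrite powcoefS0 normrM expn0 mul1n expnS natrM ler_pM //.
  by have := IHm 0; rewrite expn0 mul1n.
rewrite powcoefS; apply: le_trans (ler_normD _ _) _; rewrite normrM.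
apply: le_trans (_ : (m.+1 ^ i * n ^ m)%:R + n%:R * (m.+1 ^ i.+1 * n ^ m)%:R <= _).
  by rewrite lerD // ler_pM.
rewrite -natrM -natrD ler_nat.
apply: leq_trans (_ : m.+2 ^ i * (m.+2 * n ^ m.+1) <= _)%N; last first.
  by rewrite mulnA -expnSr.
have H : (m.+1 ^ i <= m.+2 ^ i)%N by case: (i) => // k; rewrite leq_exp2r.
apply: leq_trans (_ : m.+1 ^ i * (m.+2 * n ^ m.+1) <= _)%N; last first.
  by rewrite leq_mul2r H orbT.
rewrite !expnS; set x := (m.+1 ^ i)%N; set y := (n ^ m)%N.
by nia.
Qed.

End PowerCoefficientBounds.

(** Order comparisons in [R[i]] force equal imaginary parts, so the claim reduces to the real
    geometric sequence. *)
Lemma geometric_lt_near (R : realType) (C q eps : R[i]) :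
  0 <= C -> 0 <= q < 1 -> 0 < eps -> \forall m \near \oo, C * q ^+ m < eps.
Proof.
case: C => C1 C2; case: q => q1 q2; case: eps => e1 e2.
rewrite !lecE !ltcE /= => /andP[/eqP -> C0] /andP[/andP[/eqP -> q0] /andP[_ ql]].
move=> /andP[/eqP -> e0].
have : C1 * q1 ^+ m @[m --> \oo] --> (0 : R).
  by apply: cvg_geometric; rewrite ger0_norm.
move=> /cvgrPdist_lt /(_ _ e0); apply: filterS => m.
rewrite sub0r normrN ger0_norm ?mulr_ge0 ?exprn_ge0 // => H.
by move: H; rewrite -ltcR rmorphM rmorphXn.
Qed.

(** * Laurent coefficients and remainders of partial fractions *)

Section ExpansionAtInfinity.
Variables (R : realType) (a n : nat) (c : 'M[int]_(a, n.+1)).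

Definition laurent_coef (d : nat) : R :=
  \sum_(i < a) \sum_(j < n.+1) (c i j)%:~R * powcoef d.-1 i (- j%:R).

Definition remainder_num (m : nat) (t : R[i]^o) : R[i] :=
  \sum_(i < a) \sum_(j < n.+1) (c i j)%:~R *
    \sum_(l < i.+1) powcoef m l (- j%:R) / (t + j%:R) ^+ (i.+1 - l).

Lemma partial_fraction_remainder (m : nat) (t : R[i]^o) :
  n%:R < `|t| ->
  partial_fraction R c t - \sum_(d < m) (laurent_coef d.+1)%:C * t ^- d.+1
  = (t ^+ m)^-1 * remainder_num m t.
Proof.
move=> nt.
have t0 : t != 0 by rewrite -normr_gt0 (le_lt_trans _ nt).
have tj (j : 'I_n.+1) : t - (- j%:R) != 0.
  rewrite -normr_gt0; apply: lt_le_trans (lerB_dist _ _).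
  by rewrite normrN normr_nat subr_gt0 (le_lt_trans _ nt) // ler_nat -ltnS.
rewrite /remainder_num mulr_sumr /partial_fraction.
have -> : \sum_(d < m) (laurent_coef d.+1)%:C * t ^- d.+1 =
  \sum_(i < a) \sum_(j < n.+1) (c i j)%:~R *
    \sum_(d < m) powcoef d i (- j%:R) / t ^+ d.+1.
  under eq_bigr => d _.
    rewrite /laurent_coef rmorph_sum /= mulr_suml.
    under eq_bigr => i _.
      rewrite rmorph_sum mulr_suml.
      under eq_bigr => j _.
        rewrite rmorphM /= rmorph_int (map_powcoef (real_complex R)).
        rewrite rmorphN /= rmorph_nat -mulrA; over.
      over.
    over.
  rewrite exchange_big; apply: eq_bigr => i _ /=.
  rewrite exchange_big; apply: eq_bigr => j _ /=.
  by rewrite mulr_sumr.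
rewrite -sumrB; apply: eq_bigr => i _; rewrite -sumrB mulr_sumr.
apply: eq_bigr => j _; rewrite -mulrBr mulrCA; congr (_ * _).
by have := inv_pow_expansion i m t0 (tj j); rewrite opprK.
Qed.

(** The constant may depend on [t] and [y] but not on [m], which suffices for convergence at a fixed
    [t]. *)
Lemma remainder_num_le (t : R[i]^o) (y : R[i]) :
  0 < y -> exists2 C : R[i], 0 <= C &
  forall m, `|remainder_num m t| <= C * (n%:R + y) ^+ m.
Proof.
move=> y0.
exists (\sum_(i < a) \sum_(j < n.+1) `|(c i j)%:~R| *
  \sum_(l < i.+1) (`|(t + j%:R) ^+ (i.+1 - l)|^-1 * y ^- l)).
  apply: sumr_ge0 => i _; apply: sumr_ge0 => j _; rewrite mulr_ge0 //.
  apply: sumr_ge0 => l _; rewrite mulr_ge0 ?invr_ge0 //.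
  by rewrite exprn_ge0 ?ltW.
move=> m; rewrite mulr_suml; apply: le_trans (ler_norm_sum _ _ _) _.
apply: ler_sum => i _; rewrite mulr_suml; apply: le_trans (ler_norm_sum _ _ _) _.
apply: ler_sum => j _; rewrite normrM -mulrA ler_wpM2l // mulr_suml.
apply: le_trans (ler_norm_sum _ _ _) _; apply: ler_sum => l _.
rewrite normrM normfV mulrC -mulrA ler_wpM2l ?invr_ge0 //.
rewrite mulrC ler_pdivlMr ?exprn_gt0 //.
apply: le_trans (powcoef_geometric _ _ _ (ltW y0)) _.
rewrite lerXn2r ?nnegrE ?addr_ge0 ?(ltW y0) //.
by rewrite lerD2r normrN normr_nat ler_nat -ltnS.
Qed.

Lemma expansion_partial_fraction :
  expansion_at_infty (partial_fraction R c) (fun d => (laurent_coef d)%:C) n%:R.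
Proof.
move=> t; rewrite rmorph_nat => nt.
have t0 : 0 < `|t| by apply: le_lt_trans nt.
pose y : R[i] := (`|t| - n%:R) / 2.
have y0 : 0 < y by rewrite divr_gt0 ?subr_gt0.
have q1 : 0 <= (n%:R + y) / `|t| < 1.
  rewrite divr_ge0 ?addr_ge0 ?(ltW y0) //= ltr_pdivrMr // mul1r -subr_gt0.
  have -> : `|t| - (n%:R + y) = y by rewrite /y; field.
  by [].
have [C C0 HC] := remainder_num_le t y0.
apply/cvgrPdist_lt => eps eps0.
have := geometric_lt_near C0 q1 eps0.
apply: filterS => m; apply: le_lt_trans.
rewrite /series /= big_mkord partial_fraction_remainder //.
by rewrite normrM normfV normrX expr_div_n mulrA mulrC ler_wpM2r.
Qed.

(** The function equals its remainder after [p - 1] terms, and [remainder_num] supplies one further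
    factor [O(1 / t)]. For [p = 0] the truncated predecessor is harmless because [|t| >= 1]. *)
Lemma bigO_partial_fraction (p : nat) :
  (forall d, (0 < d < p)%N -> laurent_coef d = 0) ->
  partial_fraction R c =O_ complex_infty (fun t => t ^- p).
Proof.
move=> A0; apply/eqO_exP.
pose C : R[i] := \sum_(i < a) \sum_(j < n.+1) `|(c i j)%:~R| *
  \sum_(l < i.+1) `|powcoef p.-1 l (- j%:R : R[i])|.
have C0 : 0 <= C.
  by apply: sumr_ge0 => i _; apply: sumr_ge0 => j _; rewrite mulr_ge0 ?sumr_ge0.
exists (C * 2 + 1); first by rewrite ltr_wpDl ?mulr_ge0.
exists (n.*2.+1%:R) => t; rewrite rmorph_nat => nt.
have nt' : n%:R < `|t|.
  by apply: le_lt_trans nt; rewrite ler_nat; lia.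
have t1 : 1 <= `|t|.
  by apply: ltW; apply: le_lt_trans nt; rewrite ler1n.
have t0 : 0 < `|t| by apply: lt_le_trans t1.
have tj (j : 'I_n.+1) : `|t| <= 2 * `|t + j%:R| /\ 1 <= `|t + j%:R|.
  have jn : j%:R <= n%:R :> R[i] by rewrite ler_nat -ltnS.
  have H : `|t| - n%:R <= `|t + j%:R|.
    rewrite -[X in `|t + X|]opprK; apply: le_trans (lerB_dist _ _).
    by rewrite normrN normr_nat lerB.
  have n2 : n%:R * 2 + 1 <= `|t|.
    by apply: le_trans (ltW nt); rewrite -natrM natr1 muln2.
  split.
    apply: le_trans (ler_wpM2l _ H) => //.
    rewrite -subr_ge0 (_ : _ - _ = `|t| - n%:R * 2); last by ring.
    by rewrite subr_ge0; apply: le_trans n2; rewrite lerDl.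
  apply: le_trans H; rewrite lerBrDl; apply: le_trans n2.
  by rewrite lerD2r -natrM ler_nat; lia.
have := partial_fraction_remainder p.-1 nt'.
rewrite big1 ?subr0 => [->|d _]; last first.
  by rewrite A0 ?mul0r //; have := ltn_ord d; lia.
rewrite normrM !normfV !normrX.
have -> : (`|t| ^+ p.-1)^-1 * `|remainder_num p.-1 t|
   = `|t| ^- p.-1.+1 * (`|t| * `|remainder_num p.-1 t|).
  by rewrite exprS; field; rewrite ?expf_neq0 ?gt_eqF.
rewrite mulrC; apply: ler_pM; rewrite ?mulr_ge0 ?invr_ge0 ?exprn_ge0 //; last first.
  rewrite lef_pV2 ?posrE ?exprn_gt0 //; case: (p) => [|k] //.
apply: le_trans (_ : C * 2 <= _); last by rewrite lerDl.
rewrite mulrC -ler_pdivlMr // -mulrA /remainder_num mulr_suml.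
apply: le_trans (ler_norm_sum _ _ _) _.
apply: ler_sum => i _; rewrite mulr_suml; apply: le_trans (ler_norm_sum _ _ _) _.
apply: ler_sum => j _; rewrite normrM -mulrA ler_wpM2l // mulr_suml.
apply: le_trans (ler_norm_sum _ _ _) _; apply: ler_sum => l _.
have [tj2 tj1] := tj j.
rewrite normrM ler_wpM2l // normfV normrX.
apply: le_trans (_ : `|t + j%:R|^-1 <= _).
  rewrite lef_pV2 ?posrE ?exprn_gt0 ?(lt_le_trans _ tj1) //.
  rewrite subSn -1?ltnS // exprS ler_peMr ?exprn_ege1 //.
rewrite ler_pdivlMr // mulrC ler_pdivrMr ?(lt_le_trans _ tj1) //.
Qed.

End ExpansionAtInfinity.

(** * Box principle for the coefficients of the partial fraction *)

(** A bound for the sum of absolute values of the [k]-th integral form over its [a * n.+1]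
    unknowns. *)
Definition siegel_weight (a n k : nat) : nat :=
  (a * n.+1 * binomp_den a k * 2 ^ (n + k))%N.

Lemma binomp_den_gt0 (a k : nat) : (0 < binomp_den a k)%N.
Proof.
by rewrite /binomp_den muln_gt0 fact_gt0 andbT prodn_gt0 // => m; exact: lcm_upto_gt0.
Qed.

(** Of the [a * n.+1] degrees of freedom, [p] are taken by the equations; [e] others pay for the
    weights and for the [q] inequalities. *)
Lemma siegel_partial_fraction (R : realType) (a n p q e : nat) (rho Y : R) :
  (0 < a)%N -> (0 < n)%N -> 1 <= rho -> 1 <= Y -> (p + e < a * n.+1)%N ->
  \prod_(k < p) (siegel_weight a n k)%:R *
    \prod_(v < q) ((2 * a * n.+1)%:R * rho ^+ (q - v)) <= Y ^+ e ->
  exists c : 'M[int]_(a, n.+1),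
  [/\ c != 0, forall i j, `|c i j|%:~R <= Y,
      forall d, (0 < d <= p)%N -> laurent_coef R c d = 0 &
      forall v : 'I_q, `|laurent_coef R c (p + v).+1| <=
        rho ^- (q - v) * n%:R ^+ (p + v).+1 * (p + v).+1%:R ^+ a * Y].
Proof.
move=> a0 n0 rho1 Y1 pe HY.
have Y0 : 0 <= Y by apply: le_trans Y1.
have rho0 : 0 < rho by apply: lt_le_trans rho1.
pose H := Num.trunc Y.
have /andP[HleY YltH] := truncn_itv Y0; rewrite -/H in HleY YltH.
pose U := ('I_a * 'I_n.+1)%type; pose V := ('I_p + 'I_q)%type.
pose f (v : V) (u : U) : R := match v with
  | inl k => (binomp_den a k)%:R * (binomp R k \Po ('X - u.2%:R%:P))`_u.1
  | inr v => powcoef (p + v) u.1 (- u.2%:R) end.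
pose g (v : V) : R := match v with
  | inl _ => 1
  | inr v => rho ^- (q - v) * n%:R ^+ (p + v).+1 * (p + v).+1%:R ^+ a * Y end.
(* In [g (inr v) * x v] the powers of [rho] cancel: a width smaller by [rho ^ (q - v)] costs as many
   times more boxes. *)
pose x (v : 'I_q) : R := (a * n.+1)%:R * rho ^+ (q - v).
pose B (v : V) : nat := match v with
  | inl k => (H * siegel_weight a n k).+1
  | inr v => (Num.trunc (x v)).+1 end.
have cardU : #|{: U}| = (a * n.+1)%N by rewrite card_prod !card_ord.
have x1 v : 1 <= x v.
  by rewrite /x mulr_ege1 ?exprn_ege1 // ler1n muln_gt0 a0.
have n0R : 0 < n%:R :> R by rewrite ltr0n.
have g0 v : 0 < g v.
  case: v => //= v.
  by rewrite !mulr_gt0 ?invr_gt0 ?exprn_gt0 ?ltr0n ?(lt_le_trans _ Y1).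
have HB v : H%:R * \sum_u `|f v u| < g v * (B v)%:R.
  case: v => [k|v].
    rewrite /g /B mul1r -natr1 natrM.
    apply: le_lt_trans (_ : _ <= H%:R * (siegel_weight a n k)%:R) _;
      last by rewrite ltrDl.
    rewrite ler_wpM2l //.
    apply: le_trans (_ : \sum_(u : U) (binomp_den a k * 2 ^ (n + k))%:R <= _).
      apply: ler_sum => -[i j] _ /=; rewrite normrM normr_nat natrM ler_wpM2l //.
      apply: le_trans (coef_binomp_shift_le _ _ _ _) _.
      by rewrite natrX ler_weXn2l ?ler1n // leq_add2r -ltnS.
    by rewrite sumr_const cardU -mulrnA ler_nat /siegel_weight mulnC !mulnA.
  apply: le_lt_trans (_ : _ <= g (inr v) * x v) _; last first.
    rewrite (ltr_pM2l (g0 (inr v))) /=.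
    by have /andP[] := truncn_itv (le_trans ler01 (x1 v)).
  have -> : g (inr v) * x v =
    Y * ((a * n.+1)%:R * ((p + v).+1%:R ^+ a * n%:R ^+ (p + v).+1)).
    rewrite /g /x; set s := rho ^+ _.
    have s0 : s != 0 by rewrite expf_neq0 ?gt_eqF.
    by field.
  apply: ler_pM; rewrite ?sumr_ge0 //.
  apply: le_trans (_ : \sum_(u : U) ((p + v).+1%:R ^+ a * n%:R ^+ (p + v).+1) <= _).
    apply: ler_sum => -[i j] _ /=.
    apply: le_trans (powcoef_le _ _ n0 _) _.
      by rewrite normrN normr_nat ler_nat -ltnS.
    rewrite natrM !natrX ler_pM ?exprn_ge0 //.
      by rewrite ler_weXn2l ?ler1n // ltnW.
    by rewrite ler_weXn2l ?ler1n.
  by rewrite sumr_const cardU [leRHS]mulr_natl.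
have cardB : (\prod_v B v < H.+1 ^ #|{: U}|)%N.
  rewrite cardU -(ltr_nat R) natrX big_sumType /= natrM !natr_prod.
  have H1 : 1 <= H.+1%:R :> R by rewrite ler1n.
  have H2 : 1 < H.+1%:R :> R by apply: le_lt_trans YltH.
  (* Each equation costs at most [H.+1] times its weight, each inequality at most [2 * x v]; [HY]
     then gives this bound, and [pe] leaves an exponent to spare. *)
  apply: le_lt_trans (_ : _ <= H.+1%:R ^+ (p + e)) _; last first.
    by rewrite ltr_eXn2l.
  rewrite exprD; apply: le_trans (_ : _ <= H.+1%:R ^+ p * Y ^+ e) _; last first.
    by rewrite ler_wpM2l ?exprn_ge0 // lerXn2r ?nnegrE // ltW.
  apply: le_trans (ler_wpM2l _ HY); last by rewrite exprn_ge0.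
  rewrite mulrA; apply: ler_pM; rewrite ?prodr_ge0 //.
    rewrite -[X in _ ^+ X]card_ord -prodr_const -big_split /=.
    apply: ler_prod => k _; rewrite ler0n /= -natrM ler_nat.
    have : (0 < siegel_weight a n k)%N.
      by rewrite /siegel_weight 2!muln_gt0; rewrite muln_gt0 a0 binomp_den_gt0 expn_gt0.
    by rewrite mulSn -(add1n (H * _)) leq_add2r.
  apply: ler_prod => v _; rewrite ler0n /= -natr1.
  rewrite -mulnA natrM -mulrA -/(x v) mulr_natl mulr2n lerD //.
  by have /andP[] := truncn_itv (le_trans ler01 (x1 v)).
have [z [u0 zu0] [zH zg]] := siegel_pigeonhole g0 HB cardB.
pose c : 'M[int]_(a, n.+1) := \matrix_(i, j) z (i, j).
have laurentE d : laurent_coef R c d =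
    \sum_(u : U) (z u)%:~R * powcoef d.-1 u.1 (- u.2%:R).
  rewrite /laurent_coef pair_bigA /=; apply: eq_bigr => -[i j] _ /=.
  by rewrite mxE.
exists c; split.
- apply: contraNneq zu0 => c0.
  have := congr1 (fun M : 'M[int]_(a, n.+1) => M u0.1 u0.2) c0.
  by rewrite !mxE -surjective_pairing => ->.
- move=> i j; rewrite mxE; apply: le_trans HleY.
  by rewrite -[H%:R]/(H%:Z%:~R) ler_int.
- move=> d /andP[d0 dp]; rewrite laurentE.
  (* [L] sends [X ^ (d - 1)] to the Laurent coefficient of index [d]. At [binom(X, k)], cleared of
     denominators, it is an integer of absolute value below 1, hence zero. *)
  pose L (P : {poly R}) : R := \sum_(u : U) (z u)%:~R * (P \Po ('X - u.2%:R%:P))`_u.1.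
  have Llin : linear L.
    move=> b P Q; rewrite /L scaler_sumr -big_split /=; apply: eq_bigr => u _.
    by rewrite comp_polyD comp_polyZ coefD coefZ mulrDr mulrCA.
  have LB k : (k < p)%N -> L (binomp R k) = 0.
    move=> kp; have := zg (inl (Ordinal kp)); rewrite /= => zk.
    have : (binomp_den a k)%:R * L (binomp R k) = 0.
      have -> : (binomp_den a k)%:R * L (binomp R k) =
        \sum_u (z u)%:~R *
          ((binomp_den a k)%:R * (binomp R k \Po ('X - u.2%:R%:P))`_u.1).
        by rewrite /L mulr_sumr; apply: eq_bigr => u _; rewrite mulrCA.
      apply/eqP; apply: contraTT zk; rewrite -leNgt; apply: norm_intr_ge1.
      apply: rpred_sum => u _; apply: rpredM; first exact: intr_int.
      by apply: binomp_shift_coef_int; apply: ltnW.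
    by move=> /eqP; rewrite mulf_eq0 pnatr_eq0 gtn_eqF ?binomp_den_gt0 //= => /eqP.
  have := binomp_span Llin LB (_ : (d.-1 < p)%N); rewrite prednK // => /(_ dp) L0.
  rewrite -[RHS]L0.
  apply: eq_bigr => u _; rewrite /powcoef rmorphXn /= comp_polyX.
  by rewrite rmorphN.
- by move=> v; rewrite laurentE; have := zg (inr v) => /ltW.
Qed.

(** * Size of the weights *)

Lemma harmonic_sum_le (R : realType) (a : nat) :
  \sum_(m < a) m.+1%:R^-1 <= 1 + ln a%:R :> R.
Proof.
elim: a => [|a IHa]; first by rewrite big_ord0 ln0 // addr0.
rewrite big_ord_recr /=; case: a IHa => [|a] IHa.
  by rewrite big_ord0 ln1 invr1 add0r addr0.
apply: le_trans (lerD IHa (lexx _)) _; rewrite -addrA lerD2l -lerBrDl.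
have H : ln (1 + - a.+2%:R^-1) <= - a.+2%:R^-1 :> R.
  by apply: le_ln1Dx; rewrite ltrN2 invf_lt1 ?ltr1n ?ltr0n.
rewrite -lerN2; apply: le_trans H; rewrite opprB -ln_div ?posrE ?ltr0n //.
by rewrite le_eqVlt; apply/orP; left; apply/eqP; congr ln; field.
Qed.

(** Each factor is at most [4 ^ (k / m) <= exp(2 k / m)], and the exponents form a harmonic sum. *)
Lemma binomp_den_le (R : realType) (a k : nat) :
  (binomp_den a k)%:R <= a`!%:R * expR (2 * k%:R * (1 + ln a.+1%:R)) :> R.
Proof.
rewrite /binomp_den natrM mulrC ler_wpM2l // natr_prod.
apply: le_trans (_ : expR (\sum_(m < a) 2 * k%:R * m.+1%:R^-1) <= _); last first.
  rewrite ler_expR -mulr_sumr ler_wpM2l ?mulr_ge0 //.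
  apply: le_trans (harmonic_sum_le R a) _; rewrite lerD2l.
  case: a => [|a]; first by rewrite ln0 ?ln1.
  by rewrite ler_ln ?posrE ?ltr0n // ler_nat.
rewrite expR_sum; apply: ler_prod => m _; rewrite ler0n /=.
apply: le_trans (_ : (4 ^ (k %/ m.+1))%:R <= _).
  by rewrite ler_nat lcm_upto_le.
rewrite natrX; apply: le_trans (_ : expR 2 ^+ (k %/ m.+1) <= _).
  rewrite lerXn2r ?nnegrE ?expR_ge0 //.
  have H : 2 <= expR 1 :> R by apply: le_trans (expR_ge1Dx 1); lra.
  have -> : expR 2 = expR 1 * expR 1 :> R by rewrite -expRD.
  by apply: le_trans (ler_pM _ _ H H) => //; lra.
rewrite -expRM_natl ler_expR mulrC -mulrA ler_wpM2l //.
rewrite ler_pdivlMr ?ltr0n // -natrM ler_nat; exact: leq_trunc_div.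
Qed.

Section SizeOfWeights.
Variables (R : realType) (a n : nat).
Hypothesis a0 : (0 < a)%N.

(** One constant for both kinds of forms: [a!] comes from [binomp_den], the factor 2 from rounding
    box numbers up. *)
Let C : nat := (2 * a * a`! * n.+1)%N.
Let L : R := ln a.+1%:R.

Lemma siegel_weight_le (k : nat) : (siegel_weight a n k)%:R <=
  expR (ln C%:R + n%:R * ln 2 + k%:R * (3 + 2 * L)).
Proof.
have Cpos : 0 < C%:R :> R by rewrite ltr0n /C !muln_gt0 a0 fact_gt0.
rewrite !expRD lnK ?posrE // expRM_natl lnK ?posrE //.
have -> : (siegel_weight a n k)%:R =
    (a * n.+1)%:R * ((binomp_den a k)%:R * 2 ^+ k) * 2 ^+ n :> R.
  by rewrite /siegel_weight !natrM natrX exprD; ring.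
rewrite [leRHS]mulrAC ler_wpM2r ?exprn_ge0 //.
have -> : C%:R * expR (k%:R * (3 + 2 * L)) =
  (2 * a * n.+1)%:R * (a`!%:R * expR (2 * k%:R * (1 + L)) * expR k%:R) :> R.
  rewrite (_ : k%:R * _ = 2 * k%:R * (1 + L) + k%:R); last by ring.
  by rewrite expRD /C !natrM; ring.
apply: ler_pM; rewrite ?mulr_ge0 ?exprn_ge0 //.
  by rewrite ler_nat leq_mul2r; nia.
apply: ler_pM; rewrite ?exprn_ge0 ?binomp_den_le //.
rewrite -[k%:R]mulr1 expRM_natl lerXn2r ?nnegrE ?expR_ge0 //.
by apply: le_trans (expR_ge1Dx 1); lra.
Qed.

Lemma sum_ord_le (p : nat) : \sum_(k < p) k%:R <= p%:R ^+ 2 / 2 :> R.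
Proof.
elim: p => [|p IHp]; first by rewrite big_ord0 expr0n mul0r.
rewrite big_ord_recr /=; apply: le_trans (lerD IHp (lexx _)) _.
rewrite -natr1 -subr_ge0.
by rewrite (_ : _ - _ = 2^-1); [rewrite invr_ge0|field].
Qed.

Lemma sum_rev_ord (q : nat) :
  \sum_(v < q) (q - v)%:R = q%:R * (q%:R + 1) / 2 :> R.
Proof.
elim: q => [|q IHq]; first by rewrite big_ord0 !mul0r.
rewrite big_ord_recl subn0 /=.
under eq_bigr => v _ do rewrite /bump /= add1n subSS.
by rewrite IHq -natr1; field.
Qed.

Lemma siegel_weight_prod_le (p q : nat) (rho : R) : 1 <= rho ->
  \prod_(k < p) (siegel_weight a n k)%:R *
    \prod_(v < q) ((2 * a * n.+1)%:R * rho ^+ (q - v)) <=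
  expR ((p + q)%:R * ln C%:R + p%:R * n%:R * ln 2
    + (3 + 2 * L) * (p%:R ^+ 2 / 2) + ln rho * (q%:R * (q%:R + 1) / 2)).
Proof.
move=> rho1; have rho0 : 0 < rho by apply: lt_le_trans rho1.
have Cpos : 0 < C%:R :> R by rewrite ltr0n /C !muln_gt0 a0 fact_gt0.
have L0 : 0 <= L by apply: ln_ge0; rewrite ler1n.
apply: le_trans (_ : expR (\sum_(k < p) (ln C%:R + n%:R * ln 2 + k%:R * (3 + 2 * L)))
   * expR (\sum_(v < q) (ln C%:R + (q - v)%:R * ln rho)) <= _).
  rewrite !expR_sum; apply: ler_pM.
  - by apply: prodr_ge0.
  - by apply: prodr_ge0 => v _; rewrite mulr_ge0 ?exprn_ge0 ?(ltW rho0).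
  - by apply: ler_prod => k _; rewrite ler0n siegel_weight_le.
  apply: ler_prod => v _; rewrite mulr_ge0 ?exprn_ge0 ?(ltW rho0) //=.
  rewrite expRD expRM_natl !lnK ?posrE // ler_wpM2r ?exprn_ge0 ?(ltW rho0) //.
  by rewrite ler_nat /C leq_mul2r; have := fact_gt0 a; nia.
rewrite -expRD ler_expR !big_split /= !sumr_const !card_ord -!mulr_suml sum_rev_ord.
have := ler_wpM2r (_ : 0 <= 3 + 2 * L) (sum_ord_le p).
rewrite addr_ge0 ?mulr_ge0 // => /(_ isT) H.
rewrite -[ln C%:R *+ p]mulr_natl -[ln C%:R *+ q]mulr_natl -[_ *+ p]mulr_natl natrD.
lra.
Qed.

End SizeOfWeights.

(** * Choice of parameters and conclusion *)

Lemma ln_le_sqrt (R : realType) (x : R) : 1 <= x -> ln x <= 2 * Num.sqrt x.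
Proof.
move=> x1; have x0 : 0 < x by apply: lt_le_trans x1.
have s0 : 0 < Num.sqrt x by rewrite sqrtr_gt0.
have -> : ln x = ln (Num.sqrt x) *+ 2 by rewrite -lnXn // sqr_sqrtr // ltW.
have H : ln (Num.sqrt x) <= Num.sqrt x - 1.
  rewrite -{1}[Num.sqrt x](subrK 1) addrC; apply: le_ln1Dx.
  by rewrite ltrBrDl addrN.
by rewrite mulr2n; lra.
Qed.

Theorem theorem3p1 (R : realType) (a : nat) (omega Omega r : rat)
    (ha : Omega < a%:R) (hO : omega <= Omega) (ho : 1 <= omega) (hr : 1 <= r) :
  exists2 eps : nat -> R, eps @ \oo --> (0 : R) &
  forall n rn on On : nat,
    r * n%:R = rn%:R -> omega * n%:R = on%:R -> Omega * n%:R = On%:R ->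
  exists c : 'M[int]_(a, n.+1),
    c != 0 /\
  exists A : nat -> R[i]^o,
    [/\ expansion_at_infty (partial_fraction R c) A n%:R,
        partial_fraction R c =O_ complex_infty (fun t => t ^- on),
        forall (i : 'I_a) (j : 'I_n.+1),
          `|c i j|%:~R <= chi R a omega Omega r `^ (n%:R * (1 + eps n))
      & forall d : nat, (1 <= d)%N -> (d < On)%N ->
          `|A d| <= ((ratr r : R) ^ (d%:Z - On%:Z) * n%:R ^+ d * d%:R ^+ a
                     * chi R a omega Omega r `^ (n%:R * (1 + eps n)))%:C].
Proof.
have a0 : (0 < a)%N.
  rewrite -(ltr0n rat); apply: lt_trans ha.
  by apply: lt_le_trans hO; apply: lt_le_trans ho.
pose w : R := ratr omega; pose W : R := ratr Omega; pose rho : R := ratr r.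
have w1 : 1 <= w by rewrite /w -(rmorph1 (@ratr R)) ler_rat.
have wW : w <= W by rewrite ler_rat.
have Wa : W < a%:R by rewrite -(ratr_nat R) ltr_rat.
have rho1 : 1 <= rho by rewrite /rho -(rmorph1 (@ratr R)) ler_rat.
have lrho : 0 <= ln rho by apply: ln_ge0.
pose L : R := ln a.+1%:R.
have L0 : 0 <= L by apply: ln_ge0; rewrite ler1n.
pose K : R := w * ln 2 + 3 * w ^+ 2 + w ^+ 2 * L + 2^-1 * W ^+ 2 * ln rho.
have ln20 : 0 <= ln 2 :> R by apply: ln_ge0; rewrite ler1n.
have W2 : 0 <= W ^+ 2 by apply: sqr_ge0.
have w2 : 1 <= w ^+ 2 by rewrite exprn_ege1.
have K1 : 1 <= K.
  have := mulr_ge0 W2 lrho; have := mulr_ge0 (le_trans ler01 w2) L0.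
  by have := mulr_ge0 (le_trans ler01 w1) ln20; rewrite /K; lra.
have W0 : 0 <= W by rewrite (le_trans _ wW) // (le_trans _ w1).
have aw : 0 < a%:R - w by rewrite subr_gt0; apply: le_lt_trans Wa.
have chiE : chi R a omega Omega r = expR (K / (a%:R - w)).
  by rewrite /chi natr1.
have chi_pow x : chi R a omega Omega r `^ x = expR (K / (a%:R - w) * x).
  by rewrite chiE -expRM.
pose c0 : R := ln (2 * a * a`!)%:R.
have c0_ge0 : 0 <= c0.
  by apply: ln_ge0; rewrite ler1n !muln_gt0 a0 fact_gt0.
(* Chosen to make [epsn] true: [c0 + 2] comes from [ln(n + 1) <= 2 sqrt(n + 1)], the factor 2 from
   [n + 1 <= 2 n]. *)
pose D : R := 2 * W * (c0 + 2).
have D0 : 0 <= D.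
  by rewrite /D; apply: mulr_ge0; [apply: mulr_ge0|apply: addr_ge0].
pose eps (n : nat) : R := D * Num.sqrt n.+1%:R^-1.
exists eps.
  have h : Num.sqrt n.+1%:R^-1 @[n --> \oo] --> (0 : R).
    rewrite -[X in _ --> X]sqrtr0.
    exact: (continuous_cvg _ (@sqrt_continuous R 0) (@cvg_harmonic R)).
  by rewrite -(mulr0 D); exact: (cvgM (cvg_cst D) h).
have eps0 n : 0 <= eps n by rewrite mulr_ge0 ?sqrtr_ge0.
move=> n rn on On _ omegan Omegan.
have wn : w * n%:R = on%:R by rewrite /w -(ratr_nat R n) -rmorphM /= omegan ratr_nat.
have Wn : W * n%:R = On%:R by rewrite /W -(ratr_nat R n) -rmorphM /= Omegan ratr_nat.
have normA (x : R) : `|x%:C| = `|x|%:C.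
  by rewrite normc_def /= expr0n addr0 sqrtr_sqr.
have [n0|n0] := posnP n.
  (* For [n = 0] both [on] and [On] vanish: the last bound is void, and coefficients 1 meet
     [chi ^ 0 = 1]. *)
  move: wn Wn; rewrite n0 !mulr0 => /esym/eqP; rewrite pnatr_eq0 => /eqP ->.
  move=> /esym/eqP; rewrite pnatr_eq0 => /eqP ->.
  pose c : 'M[int]_(a, 1) := const_mx 1.
  exists c; split.
    apply/eqP => /matrixP /(_ (Ordinal a0) ord0); by rewrite !mxE.
  exists (fun d => (laurent_coef R c d)%:C); split => //.
  - exact: expansion_partial_fraction.
  - by apply: bigO_partial_fraction => d; rewrite ltn0 andbF.
  - by move=> i j; rewrite mxE mul0r powRr0 normr1.
pose Y : R := chi R a omega Omega r `^ (n%:R * (1 + eps n)).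
have nR : 1 <= n%:R :> R by rewrite ler1n.
have n_ge0 : 0 <= n%:R :> R by [].
have YE : Y = expR (K / (a%:R - w) * (n%:R * (1 + eps n))) by exact: chi_pow.
have Y1 : 1 <= Y.
  rewrite YE -[leLHS]expR0 ler_expR; apply: mulr_ge0; last first.
    by apply: mulr_ge0 => //; apply: addr_ge0 => //; exact: eps0.
  by apply: divr_ge0; [exact: le_trans ler01 K1|exact: (ltW aw)].
have on0 : (0 < on)%N by rewrite -(ltr0n R) -wn; nra.
have onOn : (on <= On)%N by rewrite -(ler_nat R) -wn -Wn ler_wpM2r.
have Onan : (On < a * n)%N.
  by rewrite -(ltr_nat R) -Wn natrM ltr_pM2r // (lt_le_trans _ nR).
(* The equations are those of index [1, ..., on - 1], the inequalities those of index
   [on, ..., On - 1]; [p + e = a n - 1]. *)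
pose p := on.-1; pose q := (On - on)%N; pose e := (a * n - on)%N.
have pR : p%:R + 1 = w * n%:R :> R by rewrite natr1 /p prednK.
have qR : p%:R + q%:R + 1 = W * n%:R :> R.
  by rewrite Wn -natrD natr1; congr _%:R; rewrite /p /q -addSn prednK // subnKC.
have eR : e%:R = n%:R * (a%:R - w) :> R.
  by rewrite /e natrB ?(leq_trans onOn (ltnW Onan)) // -wn natrM; ring.
have pe : (p + e < a * n.+1)%N.
  have := leq_trans onOn (ltnW Onan); rewrite mulnS /p /e; clear -on0 a0; lia.
have epsn : W * ln (2 * a * a`! * n.+1)%:R <= n%:R * eps n.
  pose s : R := Num.sqrt n.+1%:R.
  have s0 : 0 < s by rewrite sqrtr_gt0 ltr0n.
  have ss : s ^+ 2 = n%:R + 1 by rewrite sqr_sqrtr ?natr1.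
  have s1 : 1 <= s by rewrite -(@ler_sqr _ 1 s) ?nnegrE ?(ltW s0) // ss expr1n; lra.
  rewrite natrM lnM ?posrE ?ltr0n ?muln_gt0 ?a0 ?fact_gt0 // -/c0.
  have lns := @ln_le_sqrt R n.+1%:R (_ : 1 <= _).
  rewrite ler1n in lns; move: (lns isT); rewrite -/s => {}lns.
  apply: le_trans (_ : W * ((c0 + 2) * s) <= _).
    rewrite ler_wpM2l //.
    by rewrite mulrDl lerD ?ler_peMr.
  rewrite /eps sqrtrV -/s //.
  have -> : n%:R * (D / s) = W * (c0 + 2) * ((2 * n%:R) / s).
    by rewrite /D; field; rewrite gt_eqF.
  have Wc : 0 <= W * (c0 + 2) by apply: mulr_ge0 => //; exact: addr_ge0.
  rewrite mulrA; apply: (ler_wpM2l Wc).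
  by rewrite ler_pdivlMr // -expr2 ss; lra.
have HY := siegel_weight_prod_le n a0 p q rho1.
have [|c [c_neq0 cY cA0 cA]] :=
    @siegel_partial_fraction R a n p q e rho Y a0 n0 rho1 Y1 pe.
  apply: le_trans HY _; rewrite YE -expRM_natl ler_expR -/L.
  set lC := ln _ in epsn *.
  (* As [e = n (a - w)], the denominator of [chi] cancels. The part [K n ^ 2] pays for [t2], [t3]
     and [t4], the part with [eps n] for [t1]. *)
  have -> : e%:R * (K / (a%:R - w) * (n%:R * (1 + eps n)))
      = K * (n%:R ^+ 2 + n%:R * (n%:R * eps n)).
    by rewrite eR; field; rewrite gt_eqF.
  have lC0 : 0 <= lC by apply: ln_ge0; rewrite ler1n !muln_gt0 a0 fact_gt0.
  have t1 : (p + q)%:R * lC <= K * (n%:R * (n%:R * eps n)).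
    have h1 : (p + q)%:R * lC <= n%:R * (W * lC).
      by rewrite mulrA ler_wpM2r // natrD; lra.
    apply: le_trans h1 _; apply: le_trans (_ : n%:R * (n%:R * eps n) <= _).
      by rewrite ler_wpM2l.
    exact: (ler_peMl (mulr_ge0 n_ge0 (mulr_ge0 n_ge0 (eps0 n))) K1).
  have t2 : p%:R * n%:R * ln 2 <= n%:R ^+ 2 * (w * ln 2).
    rewrite [leRHS]mulrA; apply: (ler_wpM2r ln20).
    by rewrite expr2 -mulrA [leLHS]mulrC; apply: (ler_wpM2l n_ge0); lra.
  have t3 : (3 + 2 * L) * (p%:R ^+ 2 / 2) <= n%:R ^+ 2 * (3 * w ^+ 2 + w ^+ 2 * L).
    have h : p%:R ^+ 2 <= n%:R ^+ 2 * w ^+ 2.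
      rewrite -exprMn lerXn2r ?nnegrE //; last by lra.
      by apply: mulr_ge0 => //; exact: le_trans w1.
    apply: le_trans (_ : (3 + 2 * L) * (n%:R ^+ 2 * w ^+ 2 / 2) <= _).
      by rewrite ler_wpM2l ?addr_ge0 ?mulr_ge0 // ler_wpM2r.
    have := mulr_ge0 (sqr_ge0 (n%:R : R)) (sqr_ge0 w); lra.
  have t4 : ln rho * (q%:R * (q%:R + 1) / 2) <= n%:R ^+ 2 * (2^-1 * W ^+ 2 * ln rho).
    have h : q%:R * (q%:R + 1) <= (n%:R * W) ^+ 2.
      by rewrite expr2; apply: ler_pM; rewrite ?addr_ge0 //; have := ler0n R p; lra.
    have -> : n%:R ^+ 2 * (2^-1 * W ^+ 2 * ln rho) = ln rho * ((n%:R * W) ^+ 2 / 2).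
      by field.
    by rewrite ler_wpM2l // ler_wpM2r.
  rewrite /K in t1 *; rewrite mulrDr; lra.
exists c; split => //.
exists (fun d => (laurent_coef R c d)%:C); split => //.
- exact: expansion_partial_fraction.
- apply: bigO_partial_fraction => d /andP[d0 don]; apply: cA0.
  by rewrite d0 /= -ltnS /p prednK.
move=> d d0 dOn; rewrite normA lecR -/Y.
have Y0 : 0 <= Y by apply: le_trans Y1.
have rho0 : 0 < rho by apply: lt_le_trans rho1.
have [dp|pd] := leqP d p.
  by rewrite cA0 ?d0 // normr0 !mulr_ge0 ?exprn_ge0 ?exprz_ge0 // ltW.
have pE : p.+1 = on by rewrite /p prednK.
have dv : (d - p.+1 < q)%N by rewrite /q -pE ltn_sub2r ?(leq_ltn_trans pd).
have := cA (Ordinal dv); rewrite /=.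
have -> : (p + (d - p.+1)).+1 = d by rewrite -addSn subnKC.
have -> : (q - (d - p.+1))%N = (On - d)%N.
  by rewrite /q -pE; clear -pd dOn; lia.
have -> // : rho ^ (d%:Z - On%:Z) = rho ^- (On - d).
by rewrite -opprB subzn ?(ltnW dOn) // -exprnN.
Qed.
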